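(* Let $A\in\mathbb{R}^{d\times d}$ and let $E$ be a linear subspace of $\mathbb{R}^d$. Consider the ODE $\dot x(t)=Ax(t)$, $x(0)\in\mathbb{R}^d$. Then the following statements are equivalent: (1) $E$ is invariant under $A$ (i.e. $x\in E\Rightarrow Ax\in E$), and $E\supseteq E_{A,\ge0}$, where $E_{A,\ge 0}$ denotes the linear subspace spanned by all generalized eigenvectors associated with eigenvalues of $A$ whose real parts are greater than or equal to zero. (2) There exists a seminorm $p$ with $\ker(p)=E$ such that the ODE is globally exponentially stable with respect to $p$. (3) For any seminorm $p$ with $\ker(p)=E$, the ODE is globally exponentially stable with respect to $p$. (4) There exists a pair $P,Q\in\mathcal{S}^d_{+,E}$ satisfying $A^\top P+PA+Q=0$. (5) For any $Q\in\mathcal{S}^d_{+,E}$, there exists a unique $P\in\mathcal{S}^d_{+,E}$ satisfying $A^\top P+PA+Q=0$. Consequently, the smallest subspace $E$ for which any of these statements holds is $E=E_{A,\ge0}$.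
   Context: A seminorm on $\mathbb{R}^d$ is a function $p:\mathbb{R}^d\to[0,\infty)$ that is absolutely homogeneous and satisfies the triangle inequality; $\ker(p)=\{x:p(x)=0\}$. The ODE $\dot x=Ax$ is globally exponentially stable with respect to a seminorm $p$ if there exist constants $\alpha,\beta>0$ such that $p(x(t))\le \alpha\, p(x(0))e^{-\beta t}$ for all $t\ge 0$ and every initialization $x(0)\in\mathbb{R}^d$. $\mathcal{S}^d_{+,E}$ denotes the set of symmetric positive semi-definite $d\times d$ matrices whose kernel is exactly $E$. *)

(* Defs.v *)
From HB Require Import structures.
From mathcomp Require Import all_boot all_algebra.
From mathcomp Require Import all_classical all_reals all_analysis.
From mathcomp Require Import complex.
Set Implicit Arguments.
Unset Strict Implicit.
Unset Printing Implicit Defensive.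
Import GRing.Theory Num.Theory.
Local Open Scope ring_scope.

Definition seminorm {R : realType} {d : nat} (p : 'cV[R]_d -> R) : Prop :=
  [/\ forall x, 0 <= p x,
      forall (a : R) x, p (a *: x) = `|a| * p x
    & forall x y, p (x + y) <= p x + p y].

Definition seminorm_ker_eq {R : realType} {d : nat}
  (p : 'cV[R]_d -> R) (E : {vspace 'cV[R]_d}) : Prop :=
  forall x, p x = 0 <-> x \in E.

Definition ode_solution {R : realType} {d : nat} (A : 'M[R]_d)
  (x : R -> 'cV[R]_d) : Prop :=
  forall t : R, is_derive t (1 : R) x (A *m x t).

Definition GES {R : realType} {d : nat} (A : 'M[R]_d)
  (p : 'cV[R]_d -> R) : Prop :=
  exists alpha beta : R, [/\ 0 < alpha, 0 < beta &
    forall x : R -> 'cV[R]_d, ode_solution A x ->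
      forall t : R, 0 <= t -> p (x t) <= alpha * p (x 0) * expR (- (beta * t))].

Definition psd_ker {R : realType} {d : nat} (E : {vspace 'cV[R]_d})
  (P : 'M[R]_d) : Prop :=
  [/\ P^T = P,
      forall x : 'cV[R]_d, 0 <= (x^T *m P *m x) 0 0
    & forall x : 'cV[R]_d, P *m x = 0 <-> x \in E].

Definition lyap {R : realType} {d : nat} (A P Q : 'M[R]_d) : Prop :=
  A^T *m P + P *m A + Q = 0.

Definition cplx_mx {R : realType} {m n : nat} (M : 'M[R]_(m, n)) : 'M[R[i]]_(m, n) :=
  map_mx (real_complex R) M.

Definition gen_eigvec {R : realType} {d : nat} (A : 'M[R]_d) (lam : R[i])
  (v : 'cV[R[i]]_d) : Prop :=
  v != 0 /\ exists k : nat, (cplx_mx A - lam%:M) ^+ k *m v = 0.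

Definition in_E_nonneg {R : realType} {d : nat} (A : 'M[R]_d) (x : 'cV[R]_d) : Prop :=
  exists (n : nat) (c : 'I_n -> R[i]) (lam : 'I_n -> R[i]) (v : 'I_n -> 'cV[R[i]]_d),
    [/\ forall j, 0 <= complex.Re (lam j),
        forall j, gen_eigvec A (lam j) (v j)
      & cplx_mx x = \sum_(j < n) c j *: v j].

Definition cond1 {R : realType} {d : nat} (A : 'M[R]_d) (E : {vspace 'cV[R]_d}) : Prop :=
  (forall x, x \in E -> A *m x \in E) /\ (forall x, in_E_nonneg A x -> x \in E).

(* Main.v *)
(** Fix a real matrix [N] with kernel [E]; everything is computed "modulo [E]"
    by composing with [N].

    (1) => (4).  Among the complex polynomials [f != 0] with [N f(A) = 0] (the
    characteristic polynomial is one), one has all its roots in the open left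
    half-plane: if [f] has a root [l] with nonnegative real part, write the
    characteristic polynomial as [q * ('X - l)^e] with [q(l) != 0]; the columns of
    [q(A)] are generalized eigenvectors, so [N q(A) = 0] and [f] can be replaced by
    the remainder of [q] by [f].  For such an [f = (X - l_1)...(X - l_k)], the
    vectors [y_j = N (A - l_1)...(A - l_j) x] satisfy [y_j' = l_(j+1) y_j + y_(j+1)]
    with [y_k = 0] along solutions, and a weighted sum of the [|y_j|^2] is a
    quadratic Lyapunov function.

    (4) => (5).  If [P0, Q0] solve the Lyapunov equation, a symmetric solution [P]
    vanishing on [E] for a positive semidefinite right-hand side is itself
    positive semidefinite: let [c] be the least [c >= 0] with [P + c P0 >= 0].  If
    [c > 0], then [P + c P0] has a null vector outside [E], at which the Lyapunov
    equation gives [Q0 x = 0].  Applied to [P] and [-P] with right-hand side [0]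
    this gives uniqueness, hence solvability by a dimension count.

    (4) => (3).  [x^T P x] decays exponentially, and all seminorms with kernel [E]
    are equivalent.

    (2) => (1).  If [(A - l) v] lies in [E] with [Re l >= 0], then
    [|N e^(tA) v|^2] has derivative [2 (Re l) |N e^(tA) v|^2] and tends to [0], so
    [v] lies in [E]. *)

Require Import Defs.
From HB Require Import structures.
From mathcomp Require Import all_boot all_order all_algebra.
From mathcomp Require Import all_classical all_reals all_analysis.
From mathcomp Require Import complex ring lra.
Set Implicit Arguments.
Unset Strict Implicit.
Unset Printing Implicit Defensive.
Import Order.TTheory GRing.Theory Num.Theory.
Import numFieldNormedType.Exports.
Local Open Scope ring_scope.

(** * Quadratic forms *)

Section QuadraticForms.
Context {R : realType}.

Definition bform {m n : nat} (P : 'M[R]_(m, n)) (x : 'cV[R]_m) (y : 'cV[R]_n) : R :=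
  (x^T *m P *m y) 0 0.

Lemma bformDl m n (P : 'M[R]_(m, n)) x y z :
  bform P (x + y) z = bform P x z + bform P y z.
Proof. by rewrite /bform linearD /= !mulmxDl mxE. Qed.

Lemma bformDr m n (P : 'M[R]_(m, n)) x y z :
  bform P x (y + z) = bform P x y + bform P x z.
Proof. by rewrite /bform mulmxDr mxE. Qed.

Lemma bformZl m n (P : 'M[R]_(m, n)) a x y :
  bform P (a *: x) y = a * bform P x y.
Proof. by rewrite /bform linearZ /= -!scalemxAl mxE. Qed.

Lemma bformZr m n (P : 'M[R]_(m, n)) a x y :
  bform P x (a *: y) = a * bform P x y.
Proof. by rewrite /bform -scalemxAr mxE. Qed.

Lemma bform_addmx m n (P Q : 'M[R]_(m, n)) x y :
  bform (P + Q) x y = bform P x y + bform Q x y.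
Proof. by rewrite /bform mulmxDr mulmxDl mxE. Qed.

Lemma bform_scalemx m n a (P : 'M[R]_(m, n)) x y :
  bform (a *: P) x y = a * bform P x y.
Proof. by rewrite /bform -scalemxAr -scalemxAl mxE. Qed.

Lemma bform_oppmx m n (P : 'M[R]_(m, n)) x y : bform (- P) x y = - bform P x y.
Proof. by rewrite /bform mulmxN mulNmx mxE. Qed.

Lemma bform_tr m n (P : 'M[R]_(m, n)) x y : bform P^T y x = bform P x y.
Proof.
rewrite /bform; have -> : y^T *m P^T *m x = (x^T *m P *m y)^T.
  by rewrite !trmx_mul trmxK mulmxA.
by rewrite mxE. Qed.

Lemma bform_sym n (P : 'M[R]_n) x y : P^T = P -> bform P y x = bform P x y.
Proof. by move=> symP; rewrite -bform_tr symP. Qed.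

Lemma bform_mulr m n k (P : 'M[R]_(m, n)) (B : 'M[R]_(n, k)) x y :
  bform (P *m B) x y = bform P x (B *m y).
Proof. by rewrite /bform !mulmxA. Qed.

Lemma bform_mull m n k (B : 'M[R]_(k, m)) (P : 'M[R]_(m, n)) x y :
  bform (B *m P) x y = bform P (B^T *m x) y.
Proof. by rewrite /bform trmx_mul trmxK !mulmxA. Qed.

Lemma bform0r m n (P : 'M[R]_(m, n)) x : bform P x 0 = 0.
Proof. by rewrite /bform mulmx0 mxE. Qed.

Lemma bform_ker m n (P : 'M[R]_(m, n)) x y : P *m y = 0 -> bform P x y = 0.
Proof. by move=> Py0; rewrite /bform -mulmxA Py0 mulmx0 mxE. Qed.

Lemma bform1E n (x : 'cV[R]_n) : bform 1%:M x x = \sum_(i < n) x i 0 ^+ 2.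
Proof.
rewrite /bform mulmx1 mxE; apply: eq_bigr => i _; by rewrite mxE -expr2.
Qed.

Lemma bform1_ge0 n (x : 'cV[R]_n) : 0 <= bform 1%:M x x.
Proof. by rewrite bform1E sumr_ge0// => i _; rewrite sqr_ge0. Qed.

Lemma bform1_eq0 n (x : 'cV[R]_n) : bform 1%:M x x = 0 -> x = 0.
Proof.
rewrite bform1E => /eqP; rewrite psumr_eq0 => [/allP x0|i _]; last exact: sqr_ge0.
apply/matrixP => i j; rewrite ord1 mxE; apply/eqP.
by have := x0 i (mem_index_enum _); rewrite /= sqrf_eq0.
Qed.

Definition psd {n : nat} (P : 'M[R]_n) := P^T = P /\ forall x, 0 <= bform P x x.

Lemma psd_cauchy_schwarz n (P : 'M[R]_n) x y :
  psd P -> bform P x y ^+ 2 <= bform P x x * bform P y y.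
Proof.
move=> [symP P0].
have H a b : 0 <= a ^+ 2 * bform P x x + 2 * a * b * bform P x y + b ^+ 2 * bform P y y.
  have := P0 (a *: x + b *: y).
  rewrite !bformDl !bformDr !bformZl !bformZr (bform_sym x y symP).
  by congr (0 <= _); ring.
have x0 := P0 x; have y0 := P0 y.
(* At these weights the quadratic is [bform P x x] times the gap in the inequality. *)
have Hx := H (bform P x y) (- bform P x x).
have [xp|x_eq0] := ltP 0 (bform P x x); last first.
  have {x_eq0} x0E : bform P x x = 0 by apply/eqP; rewrite eq_le x_eq0.
  by have := H (- (bform P y y + 1)) (bform P x y); rewrite x0E; nra.
rewrite -subr_ge0 -(pmulr_rge0 _ xp).
by move: Hx; congr (0 <= _); ring.
Qed.

(** Cauchy-Schwarz between [x] and [P *m x] forces [bform P x (P *m x)] to vanish, and this is the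
    squared Euclidean norm of [P *m x]. *)
Lemma psd_ker0 n (P : 'M[R]_n) x : psd P -> bform P x x = 0 -> P *m x = 0.
Proof.
move=> psdP x0; apply: bform1_eq0; apply/eqP; rewrite eq_le bform1_ge0 andbT.
have := psd_cauchy_schwarz x (P *m x) psdP.
rewrite x0 mul0r real_exprn_even_le0 ?num_real//= => /eqP.
rewrite -(bform_sym _ _ psdP.1) => <-.
by rewrite /bform mulmx1 mulmxA.
Qed.

Lemma psd_seminorm n (P : 'M[R]_n) :
  psd P -> seminorm (fun x => Num.sqrt (bform P x x)).
Proof.
move=> psdP; split=> [x|a x|x y]; first exact: sqrtr_ge0.
  by rewrite bformZl bformZr mulrA -expr2 sqrtrM ?sqr_ge0// sqrtr_sqr.
have [symP P0] := psdP.
have [x0 y0] := (sqrtr_ge0 (bform P x x), sqrtr_ge0 (bform P y y)).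
rewrite -(ler_pXn2r (ltn0Sn 1)) ?nnegrE ?addr_ge0 ?sqrtr_ge0// sqr_sqrtr//.
rewrite bformDl !bformDr (bform_sym x y symP) sqrrD !sqr_sqrtr//.
suff : bform P x y <= Num.sqrt (bform P x x) * Num.sqrt (bform P y y) by lra.
rewrite (le_trans (ler_norm _))// -sqrtrM// -sqrtr_sqr ler_wsqrtr//.
exact: psd_cauchy_schwarz.
Qed.

Lemma psd_gram m n (N : 'M[R]_(m, n)) : psd (N^T *m N).
Proof.
split=> [|x]; first by rewrite trmx_mul trmxK.
by rewrite -[N]mul1mx bform_mull bform_mulr trmxK mul1mx bform1_ge0.
Qed.

Lemma bform_gram m n (N : 'M[R]_(m, n)) x y :
  bform (N^T *m N) x y = bform 1%:M (N *m x) (N *m y).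
Proof. by rewrite bform_mull trmxK -[X in bform X]mul1mx bform_mulr. Qed.

Lemma bform_gram_eq0 m n (N : 'M[R]_(m, n)) x :
  bform (N^T *m N) x x = 0 -> N *m x = 0.
Proof. by rewrite bform_gram => /bform1_eq0. Qed.

End QuadraticForms.

(** * Comparison of seminorms with a common kernel *)

Section SeminormComparison.
Context {R : realType}.

Lemma linear_mulmx m n (f : {linear 'cV[R]_n -> 'cV[R]_m}) :
  exists M : 'M[R]_(m, n), forall x, M *m x = f x.
Proof.
exists (\matrix_(i, j) f (delta_mx j 0) i 0) => x.
rewrite [in RHS](matrix_sum_delta x) linear_sum; apply/matrixP => i k.
rewrite ord1 mxE summxE; apply: eq_bigr => j _.
by rewrite big_ord1 linearZ !mxE mulrC.
Qed.

(** [N] is the identity minus a projection onto [E], so whatever depends on [x] only modulo [E] can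
    be evaluated at [N *m x]. *)
Lemma vspace_ker_mx n (E : {vspace 'cV[R]_n}) :
  exists N : 'M[R]_n, (forall x, N *m x = 0 <-> x \in E) /\
    forall x, x - N *m x \in E.
Proof.
have [M MP] := linear_mulmx (projv E).
have NE x : (1%:M - M) *m x = x - projv E x by rewrite mulmxBl mul1mx MP.
exists (1%:M - M); split=> x; rewrite NE.
  split=> [/subr0_eq ->|xE]; first exact: memv_proj.
  by rewrite projv_id ?subrr.
by rewrite opprB addrC subrK memv_proj.
Qed.

Lemma seminorm0 n (p : 'cV[R]_n -> R) : seminorm p -> p 0 = 0.
Proof. by move=> [_ pZ _]; rewrite -(scale0r 0) pZ normr0 mul0r. Qed.

Lemma seminormB n (p : 'cV[R]_n -> R) x y :
  seminorm p -> `|p x - p y| <= p (x - y).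
Proof.
move=> [_ pZ pD].
have pN z : p (- z) = p z by rewrite -scaleN1r pZ normrN1 mul1r.
have := pD (x - y) y; rewrite subrK.
have := pD (y - x) x; rewrite subrK -(opprB x y) pN.
by rewrite ler_norml; lra.
Qed.

Lemma seminorm_sum n (p : 'cV[R]_n -> R) k (f : 'I_k -> 'cV[R]_n) :
  seminorm p -> p (\sum_(i < k) f i) <= \sum_(i < k) p (f i).
Proof.
move=> sp; have [_ _ pD] := sp.
elim/big_ind2: _ => [|x a y b xa yb|//]; first by rewrite seminorm0.
by rewrite (le_trans (pD _ _))// lerD.
Qed.

Lemma seminorm_ub n (p : 'cV[R]_n -> R) : seminorm p ->
  exists2 K, 0 <= K & forall u : 'rV[R]_n, p u^T <= K * `|u|.
Proof.
move=> sp; have [p0 pZ _] := sp.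
exists (\sum_(i < n) p (delta_mx i 0)); first by rewrite sumr_ge0.
move=> u; rewrite [u^T]matrix_sum_delta (eq_bigr (fun i => u 0 i *: delta_mx i 0)).
  rewrite (le_trans (seminorm_sum _ sp))// mulr_suml ler_sum// => i _.
  rewrite pZ mulrC ler_wpM2l// [leRHS]/Num.norm/= mx_normrE.
  exact: (le_bigmax _ (fun ij => `|u ij.1 ij.2|) (0, i)).
by move=> i _; rewrite big_ord1 mxE.
Qed.

Lemma seminorm_continuous n (p : 'cV[R]_n -> R) : seminorm p ->
  continuous (fun u : 'rV[R]_n => p u^T).
Proof.
move=> sp u; have [K K0 pK] := seminorm_ub sp.
have K1 : 0 < K + 1 by rewrite ltr_wpDl.
apply/(@cvgrPdist_le _ _ _ (nbhs u)) => e e0; near=> v.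
rewrite (le_trans (seminormB _ _ sp))// -linearB/= (le_trans (pK _))//.
rewrite (@le_trans _ _ ((K + 1) * `|u - v|))// ?ler_wpM2r ?lerDl//.
rewrite mulrC -ler_pdivlMr//; near: v.
by apply: cvgr_dist_le; [exact: cvg_id|exact: divr_gt0].
Unshelve. all: by end_near. Qed.

(** A definite seminorm has a positive minimum on the compact unit sphere, and homogeneity extends
    the bound. Row vectors are used to match [EVT_min_rV]. *)
Lemma definite_seminorm_lb n (p : 'cV[R]_n -> R) : seminorm p ->
  (forall x, p x = 0 -> x = 0) ->
  exists2 c, 0 < c & forall u : 'rV[R]_n, c * `|u| <= p u^T.
Proof.
move=> sp pdef; have [p0 pZ _] := sp.
pose S := [set u : 'rV[R]_n | `|u| = 1]%classic.
(* The sphere is empty only if every vector is zero; then any constant works. *)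
have [S0|/nonemptyPn S0] := pselect (S !=set0)%classic; last first.
  exists 1 => // u; have [->|u0] := eqVneq u 0.
    by rewrite normr0 mulr0.
  suff : S (`|u|^-1 *: u) by rewrite S0.
  by rewrite /S/= normrZ normfV normr_id mulVf// normr_eq0.
have cS : compact S.
  apply: bounded_closed_compact.
    by exists 1; split=> [|M M1 u/= ->]; [exact: num_real|exact: ltW].
  apply: (@closed_comp _ _ (fun u : 'rV[R]_n => `|u|) [set 1%R]%classic).
    by move=> u _; exact: norm_continuous.
  exact: closed_eq.
have [|c cS1 cmin] := @EVT_min_rV R n (fun u => p u^T) S S0 cS.
  by apply: continuous_subspaceT; exact: seminorm_continuous.
exists (p c^T).
  rewrite lt0r p0 andbT; apply/eqP => /pdef /eqP.
  rewrite trmx_eq0 => /eqP c0; move: cS1; rewrite inE /S/= c0 normr0 => /eqP.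
  by rewrite eq_sym oner_eq0.
move=> u; have [->|u0] := eqVneq u 0; first by rewrite normr0 mulr0.
have un0 : 0 < `|u| by rewrite normr_gt0.
have : `|u|^-1 *: u \in S.
  by rewrite inE /S/= normrZ normfV normr_id mulVf// normr_eq0.
move=> /cmin; rewrite linearZ/= pZ normfV normr_id.
by rewrite ler_pdivlMl// mulrC.
Qed.

(** Adding to [p] a seminorm [g] that vanishes exactly on the fixed points of [N] makes it definite,
    so compactness applies. At [N *m x] the term [g] disappears again, while [p] and [q] take the
    same values as at [x]. *)
Lemma seminorm_dominated n (p q : 'cV[R]_n -> R) (E : {vspace 'cV[R]_n}) :
  seminorm p -> seminorm q -> seminorm_ker_eq p E ->
  (forall x, x \in E -> q x = 0) ->
  exists2 C, 0 < C & forall x, q x <= C * p x.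
Proof.
move=> sp sq pE Eq; have [p0 pZ pD] := sp; have [q0 qZ qD] := sq.
have [N [NE NP]] := vspace_ker_mx E.
have [g sg gE] : exists2 g : 'cV[R]_n -> R, seminorm g & forall x, g x = 0 <-> x = N *m x.
  exists (fun x => Num.sqrt (bform ((1%:M - N)^T *m (1%:M - N)) x x)).
    exact/psd_seminorm/psd_gram.
  move=> x; split=> [/eqP|xN].
    rewrite sqrtr_eq0 => gx; have /bform_gram_eq0 : bform ((1%:M - N)^T *m (1%:M - N)) x x = 0.
      by apply/eqP; rewrite eq_le gx (psd_gram _).2.
    by rewrite mulmxBl mul1mx => /subr0_eq.
  by rewrite bform_gram mulmxBl mul1mx -xN subrr bform0r sqrtr0.
have [g0 gZ gD] := sg.
have sr : seminorm (fun x => p x + g x).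
  split=> [x|a x|x y]; first by rewrite addr_ge0.
    by rewrite pZ gZ mulrDr.
  by have := pD x y; have := gD x y; lra.
have [|c c0 rc] := definite_seminorm_lb sr.
  move=> x r0.
  have px0 : p x = 0 by apply/eqP; rewrite eq_le p0 andbT -r0 lerDl.
  have /gE -> : g x = 0 by move: r0; rewrite px0 add0r.
  exact/NE/pE.
have [K K0 qK] := seminorm_ub sq.
have qN x : q x = q (N *m x).
  by apply/subr0_eq/eqP; rewrite -normr_le0 -(Eq _ (NP x)) seminormB.
have pN x : p (N *m x) = p x.
  by apply/esym/subr0_eq/eqP; rewrite -normr_le0 -((pE _).2 (NP x)) seminormB.
have gN x : g (N *m x) = 0.
  by apply/gE/subr0_eq; rewrite -mulmxBr; exact/NE/NP.
exists (K / c + 1); first by rewrite ltr_wpDl// divr_ge0// ltW.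
move=> x; have := rc (N *m x)^T; have := qK (N *m x)^T.
rewrite trmxK -qN pN gN addr0 => qx px.
rewrite mulrDl mul1r ler_wpDr// (le_trans qx)// -mulrA ler_wpM2l//.
by rewrite ler_pdivlMl.
Qed.

Lemma psd_ker_psd n E (P : 'M[R]_n) : psd_ker E P -> psd P.
Proof. by case. Qed.

Lemma psd_ker_eq0 n (E : {vspace 'cV[R]_n}) (P : 'M[R]_n) x :
  psd_ker E P -> bform P x x = 0 <-> x \in E.
Proof.
move=> kP; have [_ _ PE] := kP; split=> [/(psd_ker0 (psd_ker_psd kP)) /PE//|/PE].
exact: bform_ker.
Qed.

Lemma psd_ker_seminorm n (E : {vspace 'cV[R]_n}) (P : 'M[R]_n) :
  psd_ker E P -> seminorm_ker_eq (fun x => Num.sqrt (bform P x x)) E.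
Proof.
move=> kP x; have [_ P0 _] := kP; rewrite -(psd_ker_eq0 x kP); split=> [|->].
  by move/eqP; rewrite sqrtr_eq0 => Px; apply/eqP; rewrite eq_le Px P0.
exact: sqrtr0.
Qed.

Lemma psd_ker_dominated n (E : {vspace 'cV[R]_n}) (P Q : 'M[R]_n) :
  psd_ker E P -> psd Q -> (forall x, x \in E -> Q *m x = 0) ->
  exists2 C, 0 < C & forall x, bform Q x x <= C * bform P x x.
Proof.
move=> kP sQ QE; have psdP := psd_ker_psd kP.
have [|C C0 CP] := seminorm_dominated (psd_seminorm psdP) (psd_seminorm sQ)
  (psd_ker_seminorm kP).
  by move=> x /QE /bform_ker ->; exact: sqrtr0.
exists (C ^+ 2) => [|x]; first exact: exprn_gt0.
rewrite -[leLHS]sqr_sqrtr ?sQ.2// -[X in _ * X]sqr_sqrtr ?psdP.2//.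
by rewrite -exprMn lerXn2r ?nnegrE ?mulr_ge0 ?sqrtr_ge0// ltW.
Qed.

Lemma psd_ker_gram n (N : 'M[R]_n) (E : {vspace 'cV[R]_n}) :
  (forall x, N *m x = 0 <-> x \in E) -> psd_ker E (N^T *m N).
Proof.
move=> NE; have [sG G0] := psd_gram N; split=> // x; split.
  by move=> /(bform_ker x) /bform_gram_eq0 /NE.
by rewrite -mulmxA => /NE ->; rewrite mulmx0.
Qed.

End SeminormComparison.

(** * The Lyapunov equation *)

Section Lyapunov.
Context {R : realType}.

Lemma bform_inj n (P Q : 'M[R]_n) :
  (forall x y, bform P x y = bform Q x y) -> P = Q.
Proof.
move=> PQ; apply/matrixP => i j.
have := PQ (delta_mx i 0) (delta_mx j 0).
rewrite /bform -!colE !trmx_delta -!rowE.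
by rewrite !mxE.
Qed.

Lemma lyap_bform d (A P Q : 'M[R]_d) x : P^T = P -> lyap A P Q ->
  bform Q x x = - 2 * bform P x (A *m x).
Proof.
move=> symP APQ; have := bform_addmx (A^T *m P + P *m A) Q x x.
rewrite APQ bform_addmx bform_mull trmxK bform_mulr (bform_sym _ _ symP).
by rewrite /bform mulmx0 mul0mx mxE; lra.
Qed.

(** Applied to a vector of [E], the equation loses the terms in [A^T *m P] and [Q], which leaves
    [P *m (A *m x) = 0]. *)
Lemma lyap_invariant d (E : {vspace 'cV[R]_d}) (A P Q : 'M[R]_d) x :
  psd_ker E P -> psd_ker E Q -> lyap A P Q -> x \in E -> A *m x \in E.
Proof.
move=> [_ _ PE] [_ _ QE] APQ xE; apply/PE.
have := congr1 (mulmx^~ x) APQ.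
by rewrite !mulmxDl mul0mx -!mulmxA ((PE x).2 xE) ((QE x).2 xE) mulmx0 add0r addr0.
Qed.

Lemma sym_ker_bform d (E : {vspace 'cV[R]_d}) (P : 'M[R]_d) x y z :
  P^T = P -> (forall x, x \in E -> P *m x = 0) -> x - y \in E ->
  bform P x z = bform P y z.
Proof.
move=> symP PE xyE; rewrite -[x in LHS](subrK y) bformDl (bform_sym _ _ symP).
by rewrite bform_ker ?add0r//; exact: PE.
Qed.

(** With [y = N *m x], the form of [P] agrees at [x] and [y], and [- y^T P y <= |y|^2 + |P y|^2].
    This bound is a semidefinite form in [x] vanishing on [E], hence dominated by [P0]. *)
Lemma sym_ker_dominated d (E : {vspace 'cV[R]_d}) (P P0 : 'M[R]_d) :
  P^T = P -> (forall x, x \in E -> P *m x = 0) -> psd_ker E P0 ->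
  exists2 C, 0 < C & forall x, - bform P x x <= C * bform P0 x x.
Proof.
move=> symP PE kP0; have [N [NE NP]] := vspace_ker_mx E.
have sG := psd_gram N; have sH := psd_gram (P *m N).
have [||C C0 CP] := @psd_ker_dominated R d E P0 (N^T *m N + (P *m N)^T *m (P *m N)) kP0.
- split=> [|x]; first by rewrite linearD/= sG.1 sH.1.
  by rewrite bform_addmx addr_ge0 ?sG.2 ?sH.2.
- move=> x /NE Nx; rewrite mulmxDl -!mulmxA Nx !mulmx0 addr0//.
exists C => // x; apply: le_trans (CP x).
rewrite (sym_ker_bform _ symP PE (NP x)) -(bform_sym _ _ symP).
rewrite (sym_ker_bform _ symP PE (NP x)) bform_addmx !bform_gram -mulmxA.
set y := N *m x.
have := bform1_ge0 (y + P *m y); have := bform1_ge0 (P *m y); have := bform1_ge0 y.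
rewrite bformDl !bformDr.
have -> : bform 1%:M (P *m y) y = bform P y y.
  by rewrite -[P in RHS]mulmx1 bform_mull symP.
have -> : bform 1%:M y (P *m y) = bform P y y by rewrite -bform_mulr mul1mx.
lra.
Qed.

Lemma lyap_psd d (E : {vspace 'cV[R]_d}) (A P0 Q0 P Q : 'M[R]_d) :
  psd_ker E P0 -> psd_ker E Q0 -> lyap A P0 Q0 ->
  P^T = P -> (forall x, x \in E -> P *m x = 0) -> lyap A P Q -> psd Q ->
  psd P.
Proof.
move=> kP0 kQ0 APQ0 symP PE APQ psdQ; split=> //.
have [symP0 P0_ge0 P0E] := kP0.
pose S := [set c : R | 0 <= c /\ forall x, 0 <= bform P x x + c * bform P0 x x]%classic.
have S0 : (S !=set0)%classic.
  have [C C0 CP] := sym_ker_dominated symP PE kP0.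
  by exists C; split=> [|x]; [exact: ltW|rewrite -lerBlDl sub0r CP].
have lbS : lbound S 0 by move=> c [].
have hlbS : has_lbound S by exists 0.
pose c := inf S.
have c_ge0 : 0 <= c by exact: lb_le_inf.
(* The infimum is attained: otherwise [- bform P x x / bform P0 x x] would be a lower bound of [S]
   above it. *)
have cP x : 0 <= bform P x x + c * bform P0 x x.
  rewrite leNgt; apply/negP => Px; have r0 := P0_ge0 x.
  have xS e : S e -> 0 <= bform P x x + e * bform P0 x x by case.
  have [e0 Se0] := S0.
  have r1 : 0 < bform P0 x x.
    rewrite lt0r r0 andbT; apply/eqP => rx; have := xS _ Se0.
    by move: Px; rewrite /bform in rx *; rewrite rx !mulr0; lra.
  have : - bform P x x / bform P0 x x <= c.
    apply: lb_le_inf => // e /xS; rewrite ler_pdivrMr//; lra.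
  by rewrite ler_pdivrMr//; lra.
have [c0|c_gt0] := leP c 0.
  by move=> x; have := cP x; rewrite (_ : c = 0) ?mul0r ?addr0//; apply/le_anti/andP.
pose M := P + c *: P0.
have psdM : psd M.
  split=> [|x]; first by rewrite linearD linearZ/= symP symP0.
  by rewrite bform_addmx bform_scalemx.
have ME x : x \in E -> M *m x = 0.
  by move=> xE; rewrite mulmxDl -scalemxAl PE// ((P0E x).2 xE) scaler0 addr0.
have APM : lyap A M (Q + c *: Q0).
  rewrite /lyap /M mulmxDr mulmxDl -!scalemxAl -!scalemxAr.
  rewrite -[RHS](scaler0 _ c) -[RHS]add0r -{1}APQ -APQ0 !scalerDr.
  by rewrite (addrACA (A^T *m P)) [LHS]addrACA.
(* A null vector of [M] kills the form of [Q + c *: Q0]; both summands are nonnegative and [c > 0],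
   so it lies in the kernel [E] of [Q0]. *)
have kM : psd_ker E M.
  split=> [||x]; [exact: psdM.1|exact: psdM.2|split=> [Mx|]; last exact: ME].
  apply/(psd_ker_eq0 x kQ0).
  have := lyap_bform x psdM.1 APM.
  rewrite -(bform_sym _ _ psdM.1) (bform_ker _ Mx) mulr0 bform_addmx bform_scalemx.
  have := psdQ.2 x; have [_ /(_ x) + _] := kQ0; rewrite -/(bform Q0 x x).
  move=> Q0x Qx /eqP; rewrite paddr_eq0 ?mulr_ge0//.
  by rewrite mulf_eq0 (gt_eqF c_gt0)/= => /andP[_ /eqP].
have [C C0 CP] := psd_ker_dominated kM (psd_ker_psd kP0) (fun x => (P0E x).2).
(* As [P0 <= C * M] for forms, [P + (c - C^-1) *: P0] is still semidefinite, against the minimality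
   of [c]. The maximum with 0 keeps [e] in [S]. *)
pose e := Num.max 0 (c - C^-1).
have Se : S e.
  split=> [|x]; first by rewrite le_max lexx.
  have := CP x; rewrite bform_addmx bform_scalemx -ler_pdivrMl// => Cx.
  have : c - C^-1 <= e by rewrite le_max lexx orbT.
  by move=> /(ler_wpM2r (P0_ge0 x)); rewrite -/(bform P0 x x) mulrBl; lra.
have := ge_inf hlbS Se; rewrite -/c leNgt gt_max c_gt0/=.
by rewrite ltrBlDr ltrDl invr_gt0 C0.
Qed.

Lemma lfun_inj_surj (K : fieldType) (V : vectType K) (f : 'End(V)) (W : {vspace V}) :
  (forall v, v \in W -> f v \in W) -> (forall v, v \in W -> f v = 0 -> v = 0) ->
  forall w, w \in W -> exists2 v, v \in W & f v = w.
Proof.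
move=> fW finj w wW; have : (f @: W)%VS = W.
  apply/eqP; rewrite eqEdim; apply/andP; split.
    by apply/subvP => _ /memv_imgP[v vW ->]; exact: fW.
  rewrite limg_dim_eq//; apply/eqP; rewrite -subv0; apply/subvP => v.
  by rewrite memv_cap memv_ker memv0 => /andP[vW /eqP fv]; rewrite (finj v).
by move=> fWE; move: wW; rewrite -{1}fWE => /memv_imgP[v vW ->]; exists v.
Qed.

(** The Lyapunov operator [L] acts on the space [W] of symmetric matrices vanishing on [E]. Its
    injectivity there gives uniqueness and, in finite dimension, existence. *)
Lemma lyap_solvable d (E : {vspace 'cV[R]_d}) (A P0 Q0 : 'M[R]_d) :
  psd_ker E P0 -> psd_ker E Q0 -> lyap A P0 Q0 ->
  forall Q, psd_ker E Q ->
   exists P, [/\ psd_ker E P, lyap A P Q &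
             forall P', psd_ker E P' -> lyap A P' Q -> P' = P].
Proof.
move=> kP0 kQ0 APQ0 Q kQ.
have [N [NE NP]] := vspace_ker_mx E.
have AE x := @lyap_invariant _ _ _ _ _ x kP0 kQ0 APQ0.
(* The image of [1%:M - N] is [E], so vanishing on [E] becomes a linear equation and [W] an
   intersection of kernels. *)
have killE (P : 'M[R]_d) : P *m (1%:M - N) = 0 <-> forall x, x \in E -> P *m x = 0.
  split=> [P0N x /NE Nx|PE].
    by rewrite -[x](subr0 x) -Nx -{1}[x]mul1mx -mulmxBl mulmxA P0N mul0mx.
  apply: bform_inj => x y; rewrite bform_mulr mulmxBl mul1mx.
  by rewrite bform_ker ?PE// /bform mulmx0 mul0mx mxE.
pose W := (lker (linfun (idfun \- @trmx R d d)) :&: lker (linfun (mulmxr (1%:M - N))))%VS.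
have inW P : (P \in W) <-> P^T = P /\ forall x, x \in E -> P *m x = 0.
  rewrite memv_cap !memv_ker !lfunE/=; split.
    by move=> /andP[/eqP/subr0_eq PT /eqP/killE PE].
  by move=> [PT /killE PN]; rewrite PN eqxx andbT subr_eq0 PT.
pose L := linfun (mulmx A^T \+ mulmxr A).
have LE P : L P = A^T *m P + P *m A by rewrite lfunE.
(* By [lyap_psd] with right-hand side 0, both [D] and [- D] are semidefinite, so the form of [D] is
   zero. *)
have uniq D : D \in W -> L D = 0 -> D = 0.
  move=> /inW[symD DE]; rewrite LE => AD.
  have psd0 : psd (0 : 'M[R]_d).
    by split=> [|x]; rewrite ?trmx0// /bform mulmx0 mul0mx mxE.
  have pD := lyap_psd kP0 kQ0 APQ0 symD DE (etrans (addr0 _) AD) psd0.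
  have symND : (- D)^T = - D by rewrite linearN/= symD.
  have NDE x : x \in E -> - D *m x = 0 by move=> xE; rewrite mulNmx DE// oppr0.
  have NAD : lyap A (- D) 0.
    by rewrite /lyap mulmxN mulNmx -opprD AD oppr0 addr0.
  have pND := lyap_psd kP0 kQ0 APQ0 symND NDE NAD psd0.
  apply: bform_inj => x y; rewrite [RHS]/bform mulmx0 mul0mx mxE.
  apply: bform_ker; apply: psd_ker0 => //; apply/eqP; rewrite eq_le pD.2 andbT.
  by have := pND.2 y; rewrite bform_oppmx oppr_ge0.
have LW P : P \in W -> L P \in W.
  move=> /inW[symP PE]; apply/inW; rewrite LE; split=> [|x xE].
    by rewrite linearD/= !trmx_mul trmxK symP addrC.
  by rewrite mulmxDl -!mulmxA PE// mulmx0 PE ?addr0//; exact: AE.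
have WQ : - Q \in W.
  have [symQ _ QE] := kQ; apply/inW; split=> [|x /QE Qx].
    by rewrite linearN/= symQ.
  by rewrite mulNmx Qx oppr0.
have [P PW LP] := lfun_inj_surj LW uniq WQ.
have [symP PE] := (inW P).1 PW.
have APQ : lyap A P Q by rewrite /lyap -LE LP addNr.
have psdP := lyap_psd kP0 kQ0 APQ0 symP PE APQ (psd_ker_psd kQ).
exists P; split=> //.
  split=> [||x]; [exact: psdP.1|exact: psdP.2|split=> [Px|]; last exact: PE].
  apply/(psd_ker_eq0 x kQ); rewrite (lyap_bform x symP APQ).
  by rewrite -(bform_sym _ _ symP) (bform_ker _ Px) mulr0.
move=> P' [symP' _ P'E] APQ'; apply/subr0_eq/uniq.
  by rewrite memvB//; apply/inW; split=> // x /P'E.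
by rewrite linearB/= LP LE -[X in X - _](addrK Q) APQ' sub0r opprK addNr.
Qed.

End Lyapunov.

(** * Lyapunov functions from negative real parts *)

Section ComplexMatrices.
Context {R : realType}.
Implicit Types (m n : nat).

Definition mxRe {m n : nat} (M : 'M[R[i]]_(m, n)) : 'M[R]_(m, n) := map_mx (@complex.Re R) M.
Definition mxIm {m n : nat} (M : 'M[R[i]]_(m, n)) : 'M[R]_(m, n) := map_mx (@complex.Im R) M.

Lemma mxReIm m n (M N : 'M[R[i]]_(m, n)) :
  mxRe M = mxRe N -> mxIm M = mxIm N -> M = N.
Proof.
move=> /matrixP MR /matrixP MI; apply/matrixP => i j.
have := MR i j; have := MI i j; rewrite !mxE.
by case: (M i j) (N i j) => [a b] [c e] /= -> ->.
Qed.

Lemma mxRe_cplx m n (X : 'M[R]_(m, n)) : mxRe (cplx_mx X) = X.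
Proof. by apply/matrixP => i j; rewrite !mxE. Qed.

Lemma mxIm_cplx m n (X : 'M[R]_(m, n)) : mxIm (cplx_mx X) = 0.
Proof. by apply/matrixP => i j; rewrite !mxE. Qed.

Lemma mxRe0 m n : mxRe (0 : 'M[R[i]]_(m, n)) = 0.
Proof. by apply/matrixP => i j; rewrite !mxE. Qed.

Lemma mxIm0 m n : mxIm (0 : 'M[R[i]]_(m, n)) = 0.
Proof. by apply/matrixP => i j; rewrite !mxE. Qed.

Lemma cplx_mx0 m n : cplx_mx (0 : 'M[R]_(m, n)) = 0.
Proof. exact: map_mx0. Qed.

Lemma mxReD m n (M N : 'M[R[i]]_(m, n)) : mxRe (M + N) = mxRe M + mxRe N.
Proof. by apply/matrixP => i j; rewrite !mxE; case: (M i j) (N i j) => [a b] []. Qed.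

Lemma mxImD m n (M N : 'M[R[i]]_(m, n)) : mxIm (M + N) = mxIm M + mxIm N.
Proof. by apply/matrixP => i j; rewrite !mxE; case: (M i j) (N i j) => [a b] []. Qed.

Lemma mxReZ m n (a : R[i]) (M : 'M[R[i]]_(m, n)) :
  mxRe (a *: M) = complex.Re a *: mxRe M - complex.Im a *: mxIm M.
Proof. by apply/matrixP => i j; rewrite !mxE; case: a (M i j) => [a b] []. Qed.

Lemma mxImZ m n (a : R[i]) (M : 'M[R[i]]_(m, n)) :
  mxIm (a *: M) = complex.Re a *: mxIm M + complex.Im a *: mxRe M.
Proof. by apply/matrixP => i j; rewrite !mxE; case: a (M i j) => [a b] []. Qed.

Lemma mxRe_mulr m n k (M : 'M[R[i]]_(m, n)) (B : 'M[R]_(n, k)) :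
  mxRe (M *m cplx_mx B) = mxRe M *m B.
Proof.
apply/matrixP => i j; rewrite !mxE (big_morph (@complex.Re R) (id1 := 0) (op1 := +%R)) //.
  by apply: eq_bigr => l _; rewrite !mxE; case: (M i l) => a b /=; rewrite mulr0 subr0.
by move=> [a b] [].
Qed.

Lemma mxIm_mulr m n k (M : 'M[R[i]]_(m, n)) (B : 'M[R]_(n, k)) :
  mxIm (M *m cplx_mx B) = mxIm M *m B.
Proof.
apply/matrixP => i j; rewrite !mxE (big_morph (@complex.Im R) (id1 := 0) (op1 := +%R)) //.
  by apply: eq_bigr => l _; rewrite !mxE; case: (M i l) => a b /=; rewrite mulr0 add0r.
by move=> [a b] [].
Qed.

Lemma cplx_mxM m n k (B : 'M[R]_(m, n)) (C : 'M[R]_(n, k)) :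
  cplx_mx (B *m C) = cplx_mx B *m cplx_mx C.
Proof. exact: map_mxM. Qed.

Lemma mxRe_mull m n k (B : 'M[R]_(m, n)) (M : 'M[R[i]]_(n, k)) :
  mxRe (cplx_mx B *m M) = B *m mxRe M.
Proof.
apply: trmx_inj; rewrite trmx_mul.
by have := mxRe_mulr M^T B^T; rewrite /mxRe /cplx_mx -!map_trmx -!trmx_mul -!map_trmx.
Qed.

Lemma mxIm_mull m n k (B : 'M[R]_(m, n)) (M : 'M[R[i]]_(n, k)) :
  mxIm (cplx_mx B *m M) = B *m mxIm M.
Proof.
apply: trmx_inj; rewrite trmx_mul.
by have := mxIm_mulr M^T B^T; rewrite /mxIm /cplx_mx -!map_trmx -!trmx_mul -!map_trmx.
Qed.

End ComplexMatrices.

Section LyapunovConstruction.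
Context {R : realType}.

(* [horner_mx] only exists in positive dimension, hence the explicit product of the
   factors [A - l]. *)
Definition mul_factors {m d : nat} (A : 'M[R]_d) (M : 'M[R[i]]_(m, d)) (s : seq R[i]) :=
  foldl (fun M l => M *m (cplx_mx A - l%:M)) M s.

(** Induction on the factors: [|M x|^2] decays at rate [- 2 Re l] up to a coupling with [M' x].
    Since [P'] dominates [|M' x|^2], a multiple of [P'] absorbs this coupling. *)
Lemma lyap_of_factors m d (E : {vspace 'cV[R]_d}) (A : 'M[R]_d)
    (M : 'M[R[i]]_(m, d)) (s : seq R[i]) :
  (forall x, x \in E -> A *m x \in E) ->
  (forall x, x \in E -> M *m cplx_mx x = 0) ->
  (forall l, l \in s -> complex.Re l < 0) ->
  mul_factors A M s = 0 ->
  exists (P : 'M[R]_d) (delta : R),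
    [/\ psd P, 0 < delta, forall x, x \in E -> P *m x = 0,
        forall x, bform ((mxRe M)^T *m mxRe M) x x + bform ((mxIm M)^T *m mxIm M) x x
                  <= bform P x x
      & forall x, 2 * bform P x (A *m x) <= - delta * bform P x x].
Proof.
move=> AE; elim: s M => [|l s IHs] M ME sneg Ms.
  have {}Ms : M = 0 by exact: Ms.
  exists 0, 1; split=> [|//|x _|x|x]; rewrite ?mul0mx//.
  - split=> [|x]; first by rewrite trmx0.
    by rewrite /bform mulmx0 mul0mx mxE.
  - by rewrite Ms mxRe0 mxIm0 !mulmx0 /bform !mulmx0 !mul0mx mxE addr0.
  - by rewrite /bform !mulmx0 !mul0mx mxE !mulr0.
set M' := M *m (cplx_mx A - l%:M).
have M'E : M' = M *m cplx_mx A - l *: M by rewrite /M' mulmxBr mul_mx_scalar.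
have [|||P' [de' [psdP' de'0 P'E MP' AP']]] := IHs M'.
- by move=> x xE; rewrite M'E mulmxBl -scalemxAl -mulmxA -cplx_mxM !ME ?AE// scaler0 subr0.
- by move=> k ks; apply: sneg; rewrite inE ks orbT.
- exact: Ms.
have {}sneg : complex.Re l < 0 by apply: sneg; rewrite mem_head.
set a := - complex.Re l; have a0 : 0 < a by rewrite oppr_gt0.
set X := mxRe M; set Y := mxIm M; set X' := mxRe M'; set Y' := mxIm M'.
have MA : M *m cplx_mx A = M' + l *: M by rewrite M'E subrK.
have XA : X *m A = X' - a *: X - complex.Im l *: Y.
  by rewrite -mxRe_mulr MA mxReD mxReZ scaleNr opprK addrA.
have YA : Y *m A = Y' - a *: Y + complex.Im l *: X.
  by rewrite -mxIm_mulr MA mxImD mxImZ scaleNr opprK addrA.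
have XE x : x \in E -> X *m x = 0.
  by move=> /ME /(congr1 mxRe); rewrite mxRe_mulr mxRe0.
have YE x : x \in E -> Y *m x = 0.
  by move=> /ME /(congr1 mxIm); rewrite mxIm_mulr mxIm0.
(* so that [c * de'] is twice the constant [a^-1] of the AM-GM bound below *)
pose c := 2 / (de' * a).
have c0 : 0 < c by rewrite divr_gt0// mulr_gt0.
have [psdX psdY] := (psd_gram X, psd_gram Y).
(* Half of the decay of [c *: P'] pays for the coupling and half remains, whence [de' / 2]; the part
   [|M x|^2] keeps the rate [a]. *)
exists (X^T *m X + Y^T *m Y + c *: P'), (Num.min a (de' / 2)).
split=> [||x xE|x|x].
- split=> [|x].
    by rewrite !linearD linearZ/= psdX.1 psdY.1 psdP'.1.
  by rewrite !bform_addmx bform_scalemx !addr_ge0 ?psdX.2 ?psdY.2// mulr_ge0 ?psdP'.2// ltW.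
- by rewrite lt_min a0 divr_gt0.
- by rewrite !mulmxDl -!scalemxAl P'E// -!mulmxA XE// YE// !mulmx0 scaler0 !addr0.
- by rewrite !bform_addmx bform_scalemx lerDl mulr_ge0 ?psdP'.2// ltW.
rewrite !bform_addmx !bform_scalemx !bform_gram !mulmxA XA YA.
rewrite !mulmxDl !mulNmx -!scalemxAl.
have := MP' x; have := AP' x; have := psdP'.2 x; rewrite -/X' -/Y' !bform_gram.
set u := X *m x; set v := Y *m x; set u' := X' *m x; set v' := Y' *m x.
set q' := bform P' x x; set h' := bform P' x _ => q'0 Hh mq.
(* By symmetry of the dot product the rotation terms in [Im l] cancel. *)
rewrite !bformDr -!scaleNr !bformZr (bform_sym _ _ (trmx1 _ _) : bform 1%:M v u = bform 1%:M u v).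
have uu := bform1_ge0 u; have vv := bform1_ge0 v.
have ai : 0 < a^-1 by rewrite invr_gt0.
(* AM-GM absorbs the coupling terms between [M x] and [M' x]. *)
have young (y y' : 'cV[R]_m) : 2 * bform 1%:M y y' <= a * bform 1%:M y y + a^-1 * bform 1%:M y' y'.
  have := bform1_ge0 (a *: y - y').
  rewrite -[- y']scaleN1r !bformDl !bformDr !bformZl !bformZr.
  rewrite (bform_sym _ _ (trmx1 _ _) : bform 1%:M y' y = bform 1%:M y y').
  move=> /(mulr_ge0 (ltW ai)) y2; rewrite -subr_ge0; move: y2.
  by congr (0 <= _); field; rewrite gt_eqF.
have yu := young u u'; have yv := young v v'.
have dea : Num.min a (de' / 2) <= a by rewrite ge_min lexx.
have ded : Num.min a (de' / 2) <= de' / 2 by rewrite ge_min lexx orbT.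
set de := Num.min _ _ in dea ded *.
have cd : c * de' = 2 * a^-1 by rewrite /c; field; rewrite !gt_eqF.
have ch : c * (2 * h') <= - (2 * a^-1) * q'.
  have -> : - (2 * a^-1) * q' = c * (- de' * q') by rewrite -cd; ring.
  by rewrite ler_wpM2l// ltW.
have cde : de * (c * q') <= a^-1 * q'.
  have ac : de' / 2 * c = a^-1.
    by rewrite (_ : _ * c = c * de' / 2); [rewrite cd; field; rewrite gt_eqF|ring].
  by rewrite mulrA ler_wpM2r// -ac ler_wpM2r// ltW.
have dm : de * (bform 1%:M u u + bform 1%:M v v) <= a * (bform 1%:M u u + bform 1%:M v v).
  by rewrite ler_wpM2r// addr_ge0.
have am : a^-1 * (bform 1%:M u' u' + bform 1%:M v' v') <= a^-1 * q'.
  by rewrite ler_wpM2l// ltW.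
lra.
Qed.

(** Started from [N], the construction gives a [P] dominating [|N x|^2], which keeps its kernel
    inside [E]; [Q] dominates [de *: P] and inherits this. *)
Lemma lyap_exists d (E : {vspace 'cV[R]_d}) (A N : 'M[R]_d) (s : seq R[i]) :
  (forall x, x \in E -> A *m x \in E) ->
  (forall x, N *m x = 0 <-> x \in E) ->
  (forall l, l \in s -> complex.Re l < 0) ->
  mul_factors A (cplx_mx N) s = 0 ->
  exists P Q, [/\ psd_ker E P, psd_ker E Q & lyap A P Q].
Proof.
move=> AE NE sneg Ns.
have [|P [de [psdP de0 PE NP AP]]] := lyap_of_factors AE _ sneg Ns.
  by move=> x /NE Nx; rewrite -cplx_mxM Nx cplx_mx0.
have ker x : bform P x x = 0 -> x \in E.
  move=> Px; have := NP x; rewrite mxRe_cplx mxIm_cplx mulmx0 Px.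
  rewrite {2}/bform mulmx0 mul0mx mxE addr0 => Nx; apply/NE/bform_gram_eq0.
  by apply/eqP; rewrite eq_le Nx (psd_gram N).2.
pose Q := - (A^T *m P + P *m A).
have APQ : lyap A P Q by rewrite /lyap /Q subrr.
have QP x : de * bform P x x <= bform Q x x.
  by rewrite (lyap_bform _ psdP.1 APQ); have := AP x; lra.
have psdQ : psd Q.
  split=> [|x]; last by rewrite (le_trans _ (QP x))// mulr_ge0 ?psdP.2// ltW.
  by rewrite /Q linearN linearD/= !trmx_mul trmxK psdP.1 addrC.
exists P, Q; split=> //.
  split=> [||x]; [exact: psdP.1|exact: psdP.2|split=> [Px|]; last exact: PE].
  by apply: ker; exact: bform_ker.
split=> [||x]; [exact: psdQ.1|exact: psdQ.2|split=> [Qx|xE]].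
  apply: ker; have := QP x; rewrite (bform_ker _ Qx) => h.
  by apply/eqP; rewrite eq_le psdP.2 andbT -(pmulr_rle0 _ de0).
by rewrite /Q mulNmx mulmxDl -!mulmxA PE// PE ?AE// mulmx0 addr0 oppr0.
Qed.

End LyapunovConstruction.

(** * Generalized eigenvectors *)

Section GeneralizedEigenvectors.
Context {R : realType}.

Lemma mul_factorsE m d (A : 'M[R]_d.+1) (M : 'M[R[i]]_(m, d.+1)) s :
  mul_factors A M s = M *m horner_mx (cplx_mx A) (\prod_(z <- s) ('X - z%:P)).
Proof.
elim: s M => [|l s IHs] M; first by rewrite big_nil rmorph1 mulmx1.
by rewrite big_cons rmorphM rmorphB/= horner_mx_X horner_mx_C -mulmxE mulmxA -IHs.
Qed.

Lemma annihilating_poly_neg m d (A : 'M[R]_d.+1) (M : 'M[R[i]]_(m, d.+1)) :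
  (forall l v, 0 <= complex.Re l -> gen_eigvec A l v -> M *m v = 0) ->
  exists2 f : {poly R[i]}, f != 0 /\ M *m horner_mx (cplx_mx A) f = 0 &
    forall l, root f l -> complex.Re l < 0.
Proof.
move=> Mgen; set B := cplx_mx A.
have : exists2 f : {poly R[i]}, f != 0 & M *m horner_mx B f = 0.
  exists (char_poly B); first by rewrite monic_neq0// char_poly_monic.
  by rewrite Cayley_Hamilton mulmx0.
move=> [f]; have [k] := ubnP (size f); elim: k f => // k IHk f sf f0 Mf.
have [fneg|] := pselect (forall l, root f l -> complex.Re l < 0); first by exists f.
move=> /existsNP[l /not_implyP[fl /negP]]; rewrite -leNgt => l0.
have [e [q]] := multiplicity_XsubC (char_poly B) l.
rewrite monic_neq0 ?char_poly_monic//= => ql pE.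
(* By Cayley-Hamilton [(A - l)^e] kills the columns of [q(A)], so each nonzero one is a generalized
   eigenvector for [l]. *)
have Mq : M *m horner_mx B q = 0.
  apply/matrixP => a i; pose v : 'cV[R[i]]_d.+1 := horner_mx B q *m delta_mx i 0.
  suff : M *m v = 0.
    by move=> /matrixP/(_ a 0); rewrite /v mulmxA -colE [LHS]mxE => ->; rewrite !mxE.
  have [->|v0] := eqVneq v 0; first by rewrite mulmx0.
  apply: (Mgen l) => //; split=> //; exists e.
  have -> : cplx_mx A - l%:M = horner_mx B ('X - l%:P).
    by rewrite rmorphB/= horner_mx_X horner_mx_C.
  have qB : horner_mx B (('X - l%:P) ^+ e * q) = 0.
    by rewrite mulrC -pE Cayley_Hamilton.
  rewrite /v mulmxA; suff -> : horner_mx B ('X - l%:P) ^+ e *m horner_mx B q = 0.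
    exact: mul0mx.
  by rewrite mulmxE -rmorphXn -rmorphM; exact: qB.
(* The remainder is smaller than [f], and nonzero because otherwise the root [l] of [f] would be a
   root of [q]. *)
apply: (IHk (q %% f)).
- exact: leq_trans (ltn_modpN0 q f0) sf.
- by apply: contraNneq ql => qf0; rewrite (divp_eq q f) qf0 addr0 rootM fl orbT.
have := Mq; rewrite {1}(divp_eq q f) mulrC rmorphD rmorphM/= mulmxDr -mulmxE.
by rewrite mulmxA Mf mul0mx add0r.
Qed.

Lemma stable_factors m d (A : 'M[R]_d) (M : 'M[R[i]]_(m, d)) :
  (forall l v, 0 <= complex.Re l -> gen_eigvec A l v -> M *m v = 0) ->
  exists2 s, forall l, l \in s -> complex.Re l < 0 & mul_factors A M s = 0.
Proof.
(* In dimension 0 the matrix [M] has no columns and the empty list works. *)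
case: d A M => [|d] A M Mgen.
  by exists [::] => //; apply/matrixP => i [].
have [f [f0 Mf] fneg] := annihilating_poly_neg Mgen.
have [s fE] := closed_field_poly_normal f.
have lf0 : lead_coef f != 0 by rewrite lead_coef_eq0.
exists s => [l ls|].
  by apply: fneg; rewrite fE rootZ// root_prod_XsubC.
rewrite mul_factorsE; apply: (scalerI lf0).
by rewrite scaler0 scalemxAr -linearZ -fE.
Qed.

(** [in_E_nonneg A x] unfolds to this predicate at [cplx_mx x]; on complex vectors it is closed
    under complex scalars and conjugation. *)
Definition nonneg_span {d : nat} (A : 'M[R]_d) (z : 'cV[R[i]]_d) : Prop :=
  exists (n : nat) (c : 'I_n -> R[i]) (lam : 'I_n -> R[i]) (v : 'I_n -> 'cV[R[i]]_d),
    [/\ forall j, 0 <= complex.Re (lam j),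
        forall j, gen_eigvec A (lam j) (v j)
      & z = \sum_(j < n) c j *: v j].

Lemma nonneg_span0 d (A : 'M[R]_d) : nonneg_span A 0.
Proof.
exists 0, (fun=> 0), (fun=> 0), (fun=> 0); split=> [[]//|[]//|].
by rewrite big_ord0.
Qed.

Lemma nonneg_spanD d (A : 'M[R]_d) z1 z2 :
  nonneg_span A z1 -> nonneg_span A z2 -> nonneg_span A (z1 + z2).
Proof.
move=> [n1 [c1 [l1 [v1 [l10 g1 ->]]]]] [n2 [c2 [l2 [v2 [l20 g2 ->]]]]].
pose glue T (f1 : 'I_n1 -> T) (f2 : 'I_n2 -> T) (i : 'I_(n1 + n2)) :=
  match fintype.split i with inl j => f1 j | inr j => f2 j end.
exists (n1 + n2)%N, (glue _ c1 c2), (glue _ l1 l2), (glue _ v1 v2); split.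
- by move=> i; rewrite /glue; case: fintype.split.
- by move=> i; rewrite /glue; case: fintype.split.
rewrite big_split_ord; congr (_ + _); apply: eq_bigr => i _; rewrite /glue.
  by rewrite (unsplitK (inl i)).
by rewrite (unsplitK (inr i)).
Qed.

Lemma nonneg_spanZ d (A : 'M[R]_d) a z : nonneg_span A z -> nonneg_span A (a *: z).
Proof.
move=> [n [c [l [v [l0 g ->]]]]]; exists n, (fun j => a * c j), l, v; split=> //.
by rewrite scaler_sumr; apply: eq_bigr => j _; rewrite scalerA.
Qed.

Lemma nonneg_span_gen d (A : 'M[R]_d) l v :
  0 <= complex.Re l -> gen_eigvec A l v -> nonneg_span A v.
Proof.
move=> l0 g; exists 1, (fun=> 1), (fun=> l), (fun=> v); split=> //.
by rewrite big_ord1 scale1r.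
Qed.

Lemma nonneg_span_ind d (A : 'M[R]_d) (S : 'cV[R[i]]_d -> Prop) :
  S 0 -> (forall x y, S x -> S y -> S (x + y)) -> (forall a x, S x -> S (a *: x)) ->
  (forall l v, 0 <= complex.Re l -> gen_eigvec A l v -> S v) ->
  forall z, nonneg_span A z -> S z.
Proof.
move=> S0 SD SZ Sg z [n [c [l [v [l0 g ->]]]]].
by elim/big_ind: _ => // i _; apply: SZ; exact: Sg (l0 i) (g i).
Qed.

(** [A] is [l] plus [B = A - l], so it commutes with the powers of [B]. *)
Lemma gen_eigvec_mulmx d (A : 'M[R]_d) l v :
  gen_eigvec A l v -> cplx_mx A *m v != 0 -> gen_eigvec A l (cplx_mx A *m v).
Proof.
move=> [v0 [k Bv]] Av0; split=> //; exists k.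
set B := _ - _ in Bv *; have -> : cplx_mx A = B + l%:M by rewrite subrK.
rewrite mulmxDl mulmxDr mul_scalar_mx -scalemxAr Bv scaler0 addr0 mulmxA.
have -> : B ^+ k *m B = B *m B ^+ k by exact: (esym (commrX k (commr_refl B))).
by rewrite -mulmxA Bv mulmx0.
Qed.

Lemma nonneg_span_mulmx d (A : 'M[R]_d) z :
  nonneg_span A z -> nonneg_span A (cplx_mx A *m z).
Proof.
move: z; apply: nonneg_span_ind => [|x y Ax Ay|a x Ax|l v l0 g].
- by rewrite mulmx0; exact: nonneg_span0.
- by rewrite mulmxDr; exact: nonneg_spanD.
- by rewrite -scalemxAr; exact: nonneg_spanZ.
have [->|Av0] := eqVneq (cplx_mx A *m v) 0; first exact: nonneg_span0.
exact: nonneg_span_gen l0 (gen_eigvec_mulmx g Av0).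
Qed.

Lemma gen_eigvec_conj d (A : 'M[R]_d) l v :
  gen_eigvec A l v -> gen_eigvec A (conjc l) (map_mx conjc v).
Proof.
move=> [v0 [k Bv]]; split.
  apply: contra v0 => /eqP/matrixP cv0; apply/eqP/matrixP => i j.
  by have := cv0 i j; rewrite !mxE => /eqP; rewrite conjc_eq0 => /eqP.
exists k.
have cB : cplx_mx A - (conjc l)%:M = map_mx conjc (cplx_mx A - l%:M).
  apply/matrixP => i j; rewrite !mxE rmorphB rmorphMn/=.
  by rewrite oppr0.
suff -> : (cplx_mx A - (conjc l)%:M) ^+ k = map_mx conjc ((cplx_mx A - l%:M) ^+ k).
  by rewrite -map_mxM Bv map_mx0.
rewrite cB; elim: k {Bv} => [|k IHk]; first by rewrite !expr0 map_mx1.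
by rewrite !exprS IHk map_mxM.
Qed.

(** As [A] is real, the span is stable under conjugation, so it contains [(z + conj z) / 2] and
    [i (conj z - z) / 2]. This lets the real subspace [E] control complex eigenvectors. *)
Lemma nonneg_span_ReIm d (A : 'M[R]_d) z : nonneg_span A z ->
  nonneg_span A (cplx_mx (mxRe z)) /\ nonneg_span A (cplx_mx (mxIm z)).
Proof.
have cz : forall z, nonneg_span A z -> nonneg_span A (map_mx conjc z).
  apply: nonneg_span_ind => [|x y Ax Ay|a x Ax|l v l0 g].
  - by rewrite map_mx0; exact: nonneg_span0.
  - by rewrite map_mxD; exact: nonneg_spanD.
  - by rewrite map_mxZ; exact: nonneg_spanZ.
  by apply: nonneg_span_gen (gen_eigvec_conj g); case: l l0 {g}.
move=> Az; have Acz := cz _ Az; split.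
  suff -> : cplx_mx (mxRe z) = 2^-1 *: (z + map_mx conjc z).
    exact/nonneg_spanZ/nonneg_spanD.
  by apply/matrixP => i j; rewrite !mxE ReJ_add mulrC.
suff -> : cplx_mx (mxIm z) = (2^-1 * 'i%C) *: (map_mx conjc z + (-1) *: z).
  by apply/nonneg_spanZ/nonneg_spanD => //; exact: nonneg_spanZ.
by apply/matrixP => i j; rewrite !mxE ImJ_sub; ring.
Qed.

Lemma cond1_lyap d (A : 'M[R]_d) (E : {vspace 'cV[R]_d}) : cond1 A E ->
  exists P Q : 'M[R]_d, [/\ psd_ker E P, psd_ker E Q & lyap A P Q].
Proof.
move=> [AE sE]; have [N [NE _]] := vspace_ker_mx E.
have [l v l0 g|s sneg Ns] := @stable_factors _ _ A (cplx_mx N).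
  have [vRe vIm] := nonneg_span_ReIm (nonneg_span_gen l0 g).
  apply: mxReIm; rewrite ?mxRe_mull ?mxIm_mull (NE _).2 ?sE//.
    by rewrite mxRe0.
  by rewrite mxIm0.
exact: lyap_exists AE NE sneg Ns.
Qed.

(** Turns the predicate [in_E_nonneg] into a subspace: subspaces inside [S] grow by one line at a
    time until they exhaust [S], at the latest when they fill [V]. *)
Lemma linear_closed_vspace (K : fieldType) (V : vectType K) (S : V -> Prop) :
  S 0 -> (forall x y, S x -> S y -> S (x + y)) -> (forall a x, S x -> S (a *: x)) ->
  exists U : {vspace V}, forall x, x \in U <-> S x.
Proof.
move=> S0 SD SZ.
suff H : forall k, (exists U : {vspace V}, forall x, x \in U <-> S x) \/
    exists2 U : {vspace V}, forall x, x \in U -> S x & (k <= \dim U)%N.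
  have [//|[U _]] := H (\dim {:V}).+1.
  by rewrite ltnNge dimvS// subvf.
elim=> [|k [|[U US kU]]]; [|by left|].
  by right; exists 0%VS => // x; rewrite memv0 => /eqP ->.
have [UE|] := pselect (forall x, S x -> x \in U).
  by left; exists U => x; split=> [/US|/UE].
move=> /existsNP[x /not_implyP[Sx /negP xU]]; right; exists (U + <[x]>)%VS.
  move=> _ /memv_addP[u uU [_ /vlineP[a ->] ->]].
  by apply: SD; [exact: US|exact: SZ].
rewrite (leq_ltn_trans kU)// ltn_neqAle dimvS ?addvSl// andbT.
apply: contra xU => /eqP dE; suff -> : U = (U + <[x]>)%VS.
  by rewrite (subvP (addvSr _ _))// memv_line.
by apply/eqP; rewrite eqEdim addvSl dE leqnn.
Qed.

Lemma cond1_min d (A : 'M[R]_d) : exists E0 : {vspace 'cV[R]_d},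
  [/\ forall x, x \in E0 <-> in_E_nonneg A x, cond1 A E0
    & forall E : {vspace 'cV[R]_d}, cond1 A E -> (E0 <= E)%VS].
Proof.
have [|||E0 E0P] := @linear_closed_vspace _ 'cV[R]_d (in_E_nonneg A).
- rewrite /in_E_nonneg -/(nonneg_span _ _) cplx_mx0.
  exact: nonneg_span0.
- move=> x y Ax Ay; rewrite /in_E_nonneg -/(nonneg_span _ _).
  by rewrite /cplx_mx map_mxD; exact: nonneg_spanD.
- move=> a x Ax; rewrite /in_E_nonneg -/(nonneg_span _ _).
  by rewrite /cplx_mx map_mxZ; exact: nonneg_spanZ.
exists E0; split=> //.
  split=> x; last by move/E0P.
  move=> /E0P Ax; apply/E0P.
  rewrite /in_E_nonneg -/(nonneg_span _ _) cplx_mxM.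
  exact: nonneg_span_mulmx.
by move=> E [_ sE]; apply/subvP => x /E0P /sE.
Qed.

End GeneralizedEigenvectors.

(** * Decay along solutions *)

Section Derivatives.
Context {R : realType}.

Lemma is_derive_mxP m n (x : R -> 'M[R]_(m, n)) t dx :
  is_derive t (1 : R) x dx <->
  forall i j, is_derive t (1 : R) (fun s => x s i j) (dx i j).
Proof.
split=> [[dex vx] i j|xij].
  split; first exact: (derivable_mxP _ _ _).1.
  by rewrite -vx derive_mx// mxE.
have dex : derivable x t 1 by apply/derivable_mxP => i j; case: (xij i j).
split=> //; rewrite derive_mx//; apply/matrixP => i j; rewrite mxE.
by case: (xij i j).
Qed.

Lemma is_derive_sum_fun n (f : 'I_n -> R -> R) (df : 'I_n -> R) t :
  (forall i, is_derive t (1 : R) (f i) (df i)) ->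
  is_derive t (1 : R) (fun s => \sum_(i < n) f i s) (\sum_(i < n) df i).
Proof.
move=> fdf; have := is_derive_sum fdf; congr is_derive.
by apply/funext => s; rewrite fct_sumE.
Qed.

Lemma is_derive_mul_fun (f g : R -> R) df dg t :
  is_derive t (1 : R) f df -> is_derive t (1 : R) g dg ->
  is_derive t (1 : R) (fun s => f s * g s) (df * g t + f t * dg).
Proof.
move=> fd gd; apply: is_derive_eq (is_deriveM fd gd) _.
by rewrite addrC; congr (_ + _); rewrite mulrC.
Qed.

Lemma is_derive_mulmx m n k (x : R -> 'M[R]_(m, n)) (y : R -> 'M[R]_(n, k)) t dx dy :
  is_derive t (1 : R) x dx -> is_derive t (1 : R) y dy ->
  is_derive t (1 : R) (fun s => x s *m y s) (dx *m y t + x t *m dy).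
Proof.
move=> /is_derive_mxP xd /is_derive_mxP yd; apply/is_derive_mxP => i j.
have := is_derive_sum_fun (fun l => is_derive_mul_fun (xd i l) (yd l j)).
congr is_derive; first by apply/funext => s; rewrite mxE.
by rewrite big_split !mxE.
Qed.

Lemma is_derive_mulmxl m n k (B : 'M[R]_(m, n)) (y : R -> 'M[R]_(n, k)) t dy :
  is_derive t (1 : R) y dy -> is_derive t (1 : R) (fun s => B *m y s) (B *m dy).
Proof.
by move=> /(is_derive_mulmx (is_derive_cst B t 1)); rewrite mul0mx add0r.
Qed.

Lemma is_derive_mulmxr m n k (B : 'M[R]_(n, k)) (x : R -> 'M[R]_(m, n)) t dx :
  is_derive t (1 : R) x dx -> is_derive t (1 : R) (fun s => x s *m B) (dx *m B).
Proof.
by move=> xd; have := is_derive_mulmx xd (is_derive_cst B t 1); rewrite mulmx0 addr0.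
Qed.

Lemma is_derive_bform m n (P : 'M[R]_(m, n)) (x : R -> 'cV[R]_m) (y : R -> 'cV[R]_n) t dx dy :
  is_derive t (1 : R) x dx -> is_derive t (1 : R) y dy ->
  is_derive t (1 : R) (fun s => bform P (x s) (y s))
    (bform P dx (y t) + bform P (x t) dy).
Proof.
move=> xd yd; have xTd : is_derive t (1 : R) (fun s => (x s)^T) dx^T.
  apply/is_derive_mxP => i j; have := (is_derive_mxP _ _ _).1 xd j i.
  by rewrite mxE; congr is_derive; apply/funext => s; rewrite mxE.
have := (is_derive_mxP _ _ _).1 (is_derive_mulmx (is_derive_mulmxr P xTd) yd) 0 0.
by rewrite mxE.
Qed.

Lemma is_derive_expRM (c t : R) :
  is_derive t (1 : R) (fun s => expR (c * s)) (c * expR (c * t)).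
Proof.
have cd : is_derive t (1 : R) (fun s => c * s) c.
  by apply: is_derive_eq (is_deriveZ c (is_derive_id t 1)) _; exact: mulr1.
by apply: is_derive_eq (is_derive1_comp (is_derive_expR _) cd) _; rewrite mulrC.
Qed.

Lemma nonincreasing_from0 (f df : R -> R) :
  (forall t, is_derive t (1 : R) f (df t)) -> (forall t, 0 <= t -> df t <= 0) ->
  forall t, 0 <= t -> f t <= f 0.
Proof.
move=> fd df0 t t0; apply: (@ler0_derive1_le_cc _ f 0 t) => //.
- by move=> x; rewrite in_itv/= => /andP[x0 _]; rewrite derive1E derive_val df0// ltW.
- by apply: derivable_within_continuous => x _; case: (fd x).
- by rewrite in_itv/= t0 lexx.
- by rewrite in_itv/= lexx.
Qed.

(** The difference quotient at a small positive increment is 0, and the two-sided limit [l] must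
    agree with it. *)
Lemma derive0_eq0 (f : R -> R) l :
  is_derive 0 (1 : R) f l -> (forall t, 0 <= t -> f t = 0) -> l = 0.
Proof.
move=> [fd fv] f0; apply/eqP; apply: contraT => l0.
have := fd; rewrite /derivable -/('D_1 f 0) => /cvgrPdist_lt.
have : 0 < `|l| by rewrite normr_gt0.
move=> l1 /(_ _ l1)[/= e e0 /(_ (e / 2))]/=.
rewrite sub0r normrN gtr0_norm ?divr_gt0// ltr_pdivrMr// ltr_pMr// ltr1n.
move=> /(_ isT); rewrite gt_eqF ?divr_gt0// => /(_ isT).
have e2 : 0 <= e / 2 by rewrite divr_ge0// ltW.
by rewrite [_%:A]mulr1 addr0 (f0 _ e2) (f0 0 (lexx 0)) subrr scaler0 subr0 fv ltxx.
Qed.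

Lemma le0_of_exp_decay (x K b : R) :
  0 < b -> (forall t, 0 <= t -> x <= K * expR (- (b * t))) -> x <= 0.
Proof.
move=> b0 xK; rewrite leNgt; apply/negP => x0.
have K0 : 0 < K by rewrite (lt_le_trans x0)// -[K]mulr1 -expR0 -oppr0 -(mulr0 b) xK.
(* At this time the bound reads [x * expR (K / x) <= K], while [expR (K / x) >= 1 + K / x] gives
   [x + K <= K]. *)
have t0 : 0 <= K / (x * b) by rewrite ltW// divr_gt0// mulr_gt0.
have := xK _ t0.
rewrite expRN ler_pdivlMr ?expR_gt0//.
rewrite (_ : b * (K / (x * b)) = K / x); last by field; rewrite !gt_eqF.
move=> h; have := expR_ge1Dx (K / x).
move=> /(ler_wpM2l (ltW x0)); rewrite mulrDr mulr1 mulrCA divff ?gt_eqF// mulr1.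
by lra.
Qed.

End Derivatives.

Section Decay.
Context {R : realType}.

Lemma lyap_GES d (E : {vspace 'cV[R]_d}) (A P Q : 'M[R]_d) (p : 'cV[R]_d -> R) :
  psd_ker E P -> psd_ker E Q -> lyap A P Q -> seminorm p -> seminorm_ker_eq p E ->
  GES A p.
Proof.
move=> kP kQ APQ sp pE; have [p0 _ _] := sp.
have psdP := psd_ker_psd kP; have [symP P0] := psdP.
have sP := psd_seminorm psdP; have PE := psd_ker_seminorm kP.
have [C C0 PQ] := psd_ker_dominated kQ psdP (fun x => (let: And3 _ _ h := kP in (h x).2)).
have [K1 K10 pP] := seminorm_dominated sP sp PE (fun x => (pE x).2).
have [K2 K20 Pp] := seminorm_dominated sp sP pE (fun x => (PE x).2).
(* From [P <= C * Q] the form [V] below satisfies [V' <= - c V], so [V t * expR (c * t)] is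
   nonincreasing. Taking square roots halves the rate. *)
pose c := C^-1; have c0 : 0 < c by rewrite invr_gt0.
exists (K1 * K2), (c / 2); split; [exact: mulr_gt0|exact: divr_gt0|].
move=> x xsol t t0.
pose V s := bform P (x s) (x s).
have Vd s : is_derive s (1 : R) V (- bform Q (x s) (x s)).
  apply: is_derive_eq (is_derive_bform P (xsol s) (xsol s)) _.
  by rewrite (bform_sym _ _ symP) (lyap_bform _ symP APQ); ring.
have := nonincreasing_from0 (fun s => is_derive_mul_fun (Vd s) (is_derive_expRM c s)).
move=> /(_ _ t t0) VV.
have {}VV : V t * expR (c * t) <= V 0.
  move: VV; rewrite mulr0 expR0 mulr1; apply=> s s0.
  rewrite mulrA -mulrDl pmulr_lle0 ?expR_gt0// addrC subr_le0 mulrC.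
  by rewrite ler_pdivrMl// PQ.
have Vt : V t <= V 0 * expR (- (c / 2 * t)) ^+ 2.
  rewrite -expRM_natl mulrN (_ : 2%:R * (c / 2 * t) = c * t); last by field.
  by rewrite expRN ler_pdivlMr ?expR_gt0.
apply: le_trans (pP _) _; rewrite -2!mulrA ler_pM2l//.
have e0 := expR_ge0 (- (c / 2 * t)).
have := ler_wsqrtr Vt; rewrite sqrtrM ?P0// sqrtr_sqr ger0_norm//.
by move=> h; apply: le_trans h _; rewrite mulrA ler_wpM2r//; exact: Pp.
Qed.

End Decay.

(** * The matrix exponential *)

Section MatrixExponential.
Context {R : realType}.

Lemma cvg_pseries_fact (u : R ^nat) (C M t : R) : 0 <= C -> 0 <= M ->
  (forall k, `|u k| <= C * M ^+ k) -> cvgn (pseries (fun k => u k / k`!%:R) t).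
Proof.
move=> C0 M0 uM; apply: normed_cvg.
apply: (@series_le_cvg R _ (C *: exp_coeff (M * `|t|))) => [k|k|k|].
- exact: normr_ge0.
- by rewrite mulr_ge0// /exp_coeff/= divr_ge0// exprn_ge0// mulr_ge0.
- change (`|u k / k`!%:R * t ^+ k| <= C * ((M * `|t|) ^+ k / k`!%:R)).
  rewrite 2!normrM normrX normfV normr_nat exprMn.
  rewrite [leRHS](_ : _ = C * M ^+ k / k`!%:R * `|t| ^+ k).
    by rewrite ler_wpM2r ?exprn_ge0// ler_wpM2r.
  by ring.
- by apply: is_cvg_seriesZ; exact: is_cvg_series_exp_coeff.
Qed.

Lemma cvg_pseries_sum n (w : 'I_n -> R) (b : 'I_n -> R ^nat) t :
  (forall l, cvgn (pseries (b l) t)) ->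
  limn (pseries (fun k => \sum_(l < n) w l * b l k) t) =
  \sum_(l < n) w l * limn (pseries (b l) t).
Proof.
move=> bcvg; apply/cvg_lim => //.
have -> : pseries (fun k => \sum_(l < n) w l * b l k) t =
    fun N => \sum_(l < n) w l * pseries (b l) t N.
  apply/funext => N; rewrite /pseries /series/=.
  under eq_bigr do rewrite mulr_suml.
  rewrite exchange_big; apply: eq_bigr => l _; rewrite mulr_sumr.
  by apply: eq_bigr => k _; rewrite mulrA.
apply: cvg_big => [|l _]; last by apply: cvgMl_tmp; exact: bcvg.
exact: add_continuous.
Qed.

(** The sum of the absolute values of all entries bounds every row sum, which carries the
    induction. *)
Lemma mx_pow_bound d (A : 'M[R]_d) : exists2 M, 0 <= M &
  forall k i j, `|(A ^+ k) i j| <= M ^+ k.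
Proof.
pose M := \sum_(i < d) \sum_(l < d) `|A i l|.
have M0 : 0 <= M by apply: sumr_ge0 => i _; exact: sumr_ge0.
exists M => //; elim=> [|k IHk] i j.
  by rewrite !expr0 mxE; case: eqP => _; rewrite ?mulr1n ?mulr0n ?normr1 ?normr0.
rewrite !exprS -mulmxE mxE (le_trans (ler_norm_sum _ _ _))//.
rewrite (@le_trans _ _ (\sum_(l < d) `|A i l| * M ^+ k))//.
  by apply: ler_sum => l _; rewrite normrM ler_wpM2l.
rewrite -mulr_suml ler_wpM2r ?exprn_ge0//.
by rewrite /M [leRHS](bigD1 i)//= lerDl sumr_ge0// => i' _; exact: sumr_ge0.
Qed.

Definition expmx_coef {d : nat} (A : 'M[R]_d) (i j : 'I_d) (k : nat) : R :=
  (A ^+ k) i j / k`!%:R.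

(** The entrywise form gives access to scalar power series and their termwise differentiation. *)
Definition expmx {d : nat} (A : 'M[R]_d) (t : R) : 'M[R]_d :=
  \matrix_(i, j) limn (pseries (expmx_coef A i j) t).

(** Each termwise differentiation raises the power of [A] by one; the shift [r] covers the series
    and its derived series together. *)
Lemma is_cvg_expmx_shift d (A : 'M[R]_d) r i j t :
  cvgn (pseries (fun k => (A ^+ (k + r)%N) i j / k`!%:R) t).
Proof.
have [M M0 AM] := mx_pow_bound A.
apply: (@cvg_pseries_fact _ (M ^+ r) M); rewrite ?exprn_ge0// => k.
by rewrite -exprD addnC.
Qed.

Lemma pseries_diffs_shift d (A : 'M[R]_d) r i j :
  pseries_diffs (fun k => (A ^+ (k + r)%N) i j / k`!%:R) =
  (fun k => (A ^+ (k + r.+1)%N) i j / k`!%:R).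
Proof.
apply/funext => k; rewrite /pseries_diffs factS natrM addSnnS mulrC.
by rewrite invfM [_^-1 * _]mulrC mulrA mulfVK// pnatr_eq0.
Qed.

Lemma expmx_coefE d (A : 'M[R]_d) i j :
  expmx_coef A i j = (fun k => (A ^+ (k + 0)%N) i j / k`!%:R).
Proof. by apply/funext => k; rewrite addn0. Qed.

Lemma is_cvg_expmx d (A : 'M[R]_d) i j t : cvgn (pseries (expmx_coef A i j) t).
Proof. by rewrite expmx_coefE; exact: is_cvg_expmx_shift. Qed.

(** One factor of [A ^+ k.+1] is split off on the left here and on the right in [expmx_diffsr];
    comparing both shows that [A] commutes with its exponential. *)
Lemma expmx_diffsl d (A : 'M[R]_d) i j t :
  limn (pseries (pseries_diffs (expmx_coef A i j)) t) = (A *m expmx A t) i j.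
Proof.
rewrite mxE; under [RHS]eq_bigr do rewrite mxE.
rewrite -cvg_pseries_sum; last by move=> l; exact: is_cvg_expmx.
congr (limn (pseries _ t)); rewrite expmx_coefE pseries_diffs_shift.
apply/funext => k; rewrite addn1 exprS -mulmxE mxE mulr_suml.
by apply: eq_bigr => l _; rewrite mulrA.
Qed.

Lemma expmx_diffsr d (A : 'M[R]_d) i j t :
  limn (pseries (pseries_diffs (expmx_coef A i j)) t) = (expmx A t *m A) i j.
Proof.
rewrite mxE; under [RHS]eq_bigr do rewrite mxE mulrC.
rewrite -cvg_pseries_sum; last by move=> l; exact: is_cvg_expmx.
congr (limn (pseries _ t)); rewrite expmx_coefE pseries_diffs_shift.
apply/funext => k; rewrite addn1 exprSr -mulmxE mxE mulr_suml.
by apply: eq_bigr => l _; rewrite /expmx_coef mulrCA mulrA.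
Qed.

Lemma expmxC d (A : 'M[R]_d) t : expmx A t *m A = A *m expmx A t.
Proof. by apply/matrixP => i j; rewrite -expmx_diffsr expmx_diffsl. Qed.

Lemma is_derive_expmx d (A : 'M[R]_d) (t : R) :
  is_derive t (1 : R) (expmx A) (A *m expmx A t).
Proof.
apply/is_derive_mxP => i j; rewrite -expmx_diffsl.
have -> : (fun s => expmx A s i j) = (fun s => limn (pseries (expmx_coef A i j) s)).
  by apply/funext => s; rewrite mxE.
(* Termwise differentiation asks for convergence at a point farther from 0 than [t]. *)
have tK : `|t| < `|(`|t| + 1)|.
  by rewrite [ltRHS]ger0_norm ?ltrDl// addr_ge0.
apply: pseries_snd_diffs tK; first exact: is_cvg_expmx.
  by rewrite expmx_coefE pseries_diffs_shift; exact: is_cvg_expmx_shift.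
by rewrite expmx_coefE !pseries_diffs_shift; exact: is_cvg_expmx_shift.
Qed.

Lemma expmx0 d (A : 'M[R]_d) : expmx A 0 = 1%:M.
Proof.
apply/matrixP => i j; rewrite mxE; apply/cvg_lim => //.
apply: cvg_near_cst; exists 1 => // -[//|n] _.
rewrite /pseries /series/= big_nat_recl// expr0 mulr1 big1 ?addr0.
  by rewrite /expmx_coef expr0 fact0 divr1.
by move=> k _; rewrite expr0n mulr0.
Qed.

Lemma expmx_solution d (A : 'M[R]_d) (x : 'cV[R]_d) :
  ode_solution A (fun t => expmx A t *m x).
Proof.
move=> t; apply: is_derive_eq (is_derive_mulmxr x (is_derive_expmx A t)) _.
by rewrite mulmxA.
Qed.

End MatrixExponential.

(** * Stability forces the spectral condition *)

Section Necessity.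
Context {R : realType} {d : nat} (A : 'M[R]_d) (E : {vspace 'cV[R]_d}).
Context (p : 'cV[R]_d -> R).
Hypotheses (sp : seminorm p) (pE : seminorm_ker_eq p E) (GESp : GES A p).

Lemma GES_expmx_stable x t : 0 <= t -> x \in E -> expmx A t *m x \in E.
Proof.
move=> t0 /pE px; have [al [be [_ _ /(_ _ (expmx_solution A x) _ t0)]]] := GESp.
rewrite expmx0 mul1mx px mulr0 mul0r => h; apply/pE/eqP.
by have [p0 _ _] := sp; rewrite eq_le h p0.
Qed.

(** [N e^(tA) x] vanishes for [t >= 0], hence so does its derivative [N A x] at 0. *)
Lemma GES_invariant x : x \in E -> A *m x \in E.
Proof.
move=> xE; have [N [NE _]] := vspace_ker_mx E; apply/NE/matrixP => i j.
have Nd := is_derive_mulmxl N (expmx_solution A x 0).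
rewrite [RHS]mxE; have := (is_derive_mxP _ _ _).1 Nd i j; rewrite expmx0 mul1mx.
move=> /derive0_eq0; apply=> t t0.
by rewrite (NE _).2 ?mxE//; exact: GES_expmx_stable.
Qed.

(** In real terms, [(A - l) v] lies in [E] for [v = a + i b] and [l = mu + i nu]. The sum
    [V a + V b] is [|N e^(tA) v|^2], which never drops below its initial value yet decays
    exponentially. *)
Lemma GES_nonneg_mod a b w1 w2 (mu nu : R) : 0 <= mu ->
  w1 \in E -> w2 \in E ->
  A *m a = w1 + mu *: a - nu *: b -> A *m b = w2 + mu *: b + nu *: a ->
  a \in E /\ b \in E.
Proof.
move=> mu0 w1E w2E Aa Ab.
have [N [NE _]] := vspace_ker_mx E; have kG := psd_ker_gram NE.
set G := N^T *m N in kG; have psdG := psd_ker_psd kG; have [symG G0] := psdG.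
have [C C0 GP] := seminorm_dominated sp (psd_seminorm psdG) pE
  (fun x => (psd_ker_seminorm kG x).2).
have GP2 x : bform G x x <= C ^+ 2 * p x ^+ 2.
  have [p0 _ _] := sp.
  rewrite -[leLHS]sqr_sqrtr ?G0// -exprMn lerXn2r ?nnegrE ?sqrtr_ge0//.
  by rewrite mulr_ge0// ltW.
pose V x t := bform G (expmx A t *m x) (expmx A t *m x).
pose dV x t := 2 * bform G (expmx A t *m x) (expmx A t *m (A *m x)).
have Vd x t : is_derive t (1 : R) (V x) (dV x t).
  apply: is_derive_eq (is_derive_bform G (expmx_solution A x t) (expmx_solution A x t)) _.
  by rewrite (bform_sym _ _ symG) /dV !mulmxA expmxC; ring.
(* The flow preserves [E], so [w1] and [w2] contribute nothing, and the terms in [nu] cancel. *)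
have dVab t : 0 <= t -> dV a t + dV b t = 2 * mu * (V a t + V b t).
  move=> t0; rewrite /dV Aa Ab !mulmxDr mulmxN -!scalemxAr -!scaleNr.
  rewrite !bformDr !bformZr.
  have GE w x : w \in E -> bform G x (expmx A t *m w) = 0.
    by move=> wE; have [_ _ KG] := kG; apply/bform_ker/KG/GES_expmx_stable.
  rewrite (GE _ _ w1E) (GE _ _ w2E) /V.
  rewrite (bform_sym (expmx A t *m a) (expmx A t *m b) symG); ring.
pose g t := - (V a t + V b t).
have gd t : is_derive t (1 : R) g (- (dV a t + dV b t)).
  exact: is_deriveN (is_deriveD (Vd a t) (Vd b t)).
have V0 x t : 0 <= V x t by exact: G0.
have g0 t : 0 <= t -> V a 0 + V b 0 <= V a t + V b t.
  move=> t0; rewrite -[leLHS]opprK lerNl.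
  apply: (nonincreasing_from0 gd) => // s s0.
  by rewrite dVab// oppr_le0 mulr_ge0 ?addr_ge0// mulr_ge0.
have [al [be [al0 be0 GESx]]] := GESp.
have Vle x t : 0 <= t -> V x t <= C ^+ 2 * (al * p x) ^+ 2 * expR (- (2 * be * t)).
  move=> t0; rewrite (le_trans (GP2 _))// -mulrA ler_wpM2l ?sqr_ge0//.
  have := GESx _ (expmx_solution A x) t t0; rewrite expmx0 mul1mx => h.
  rewrite -[2 * be * t]mulrA -mulrN expRM_natl -exprMn lerXn2r ?nnegrE//.
    by case: sp.
  by rewrite !mulr_ge0 ?expR_ge0 ?(ltW al0)//; case: sp.
have : V a 0 + V b 0 <= 0.
  apply: (@le0_of_exp_decay _ _ (C ^+ 2 * (al * p a) ^+ 2 + C ^+ 2 * (al * p b) ^+ 2) (2 * be)).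
    by rewrite mulr_gt0.
  by move=> t t0; rewrite (le_trans (g0 t t0))// mulrDl lerD ?Vle.
move=> Vab; have [Va Vb] := (V0 a 0, V0 b 0).
have ker x : V x 0 <= 0 -> x \in E.
  rewrite /V expmx0 mul1mx => Vx; apply/(psd_ker_eq0 x kG)/eqP.
  by rewrite eq_le Vx G0.
by split; apply: ker; lra.
Qed.

(** The vector [w = (A - l) v] is killed by one power less, so by induction its parts lie in [E] and
    [GES_nonneg_mod] applies. The induction includes zero vectors, since [w] may vanish. *)
Lemma GES_gen_eigvec l v : 0 <= complex.Re l -> gen_eigvec A l v ->
  mxRe v \in E /\ mxIm v \in E.
Proof.
move=> l0 [_ [k]]; elim: k v => [|k IHk] v.
  by rewrite expr0 mul1mx => ->; rewrite mxRe0 mxIm0 mem0v.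
rewrite exprSr -mulmxE -mulmxA => /IHk[].
set w := _ *m v => wRe wIm.
have Av : cplx_mx A *m v = w + l *: v.
  by rewrite /w mulmxBl mul_scalar_mx subrK.
apply: (GES_nonneg_mod l0 wRe wIm).
  by rewrite -mxRe_mull Av mxReD mxReZ addrA.
by rewrite -mxIm_mull Av mxImD mxImZ addrA.
Qed.

Lemma GES_cond1 : cond1 A E.
Proof.
split=> x; first exact: GES_invariant.
rewrite /in_E_nonneg -/(nonneg_span _ _) => Ax.
suff : mxRe (cplx_mx x) \in E /\ mxIm (cplx_mx x) \in E by rewrite mxRe_cplx => -[].
move: (cplx_mx x) Ax; apply: nonneg_span_ind; last exact: GES_gen_eigvec.
- by rewrite mxRe0 mxIm0 mem0v.
- by move=> y z [yR yI] [zR zI]; rewrite mxReD mxImD !memvD.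
- by move=> a y [yR yI]; rewrite mxReZ mxImZ memvB ?memvD ?memvZ.
Qed.

End Necessity.

Theorem theorem3 (R : realType) (d : nat) (A : 'M[R]_d) :
  (forall E : {vspace 'cV[R]_d},
    [<-> cond1 A E;
         exists p : 'cV[R]_d -> R, [/\ seminorm p, seminorm_ker_eq p E & GES A p];
         forall p : 'cV[R]_d -> R, seminorm p -> seminorm_ker_eq p E -> GES A p;
         exists P Q : 'M[R]_d, [/\ psd_ker E P, psd_ker E Q & lyap A P Q];
         forall Q : 'M[R]_d, psd_ker E Q ->
           exists P : 'M[R]_d, [/\ psd_ker E P, lyap A P Q &
             forall P' : 'M[R]_d, psd_ker E P' -> lyap A P' Q -> P' = P]])
  /\
  (exists E0 : {vspace 'cV[R]_d},
     [/\ forall x, x \in E0 <-> in_E_nonneg A x,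
         cond1 A E0
       & forall E : {vspace 'cV[R]_d}, cond1 A E -> (E0 <= E)%VS]).
Proof.
split; last exact: cond1_min.
(* The Gram matrix of [N] has kernel [E]: it supplies the seminorm for (2) and (3) and the
   right-hand side used in (5). *)
move=> E; have [N [NE _]] := vspace_ker_mx E; have kG := psd_ker_gram NE.
have sG := psd_seminorm (psd_ker_psd kG); have GE := psd_ker_seminorm kG.
tfae.
- move=> /cond1_lyap[P [Q [kP kQ APQ]]].
  by eexists; split; [exact: sG|exact: GE|exact: lyap_GES kP kQ APQ sG GE].
- move=> [q [sq qE GESq]] p sp pE.
  have [P [Q [kP kQ APQ]]] := cond1_lyap (GES_cond1 sq qE GESq).
  exact: lyap_GES kP kQ APQ sp pE.
- by move=> GESp; apply: cond1_lyap; exact: GES_cond1 sG GE (GESp _ sG GE).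
- by move=> [P [Q [kP kQ APQ]]]; exact: lyap_solvable kP kQ APQ.
- move=> /(_ _ kG)[P [kP APG _]].
  exact: GES_cond1 sG GE (lyap_GES kP kG APG sG GE).
Qed.
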